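(* Let $\alpha>0$, $\beta\neq 0$, $R_w>0$, $\Delta>R_w$, and let $q$ be a real number. Let $\delta$ be a real number satisfying $$\delta+\beta\frac{q}{\alpha\pi^2}\left(\frac{e^{\delta\pi/2}}{\Delta}-\frac{1}{\Delta}\right)=1,$$ set $R_0=\Delta\cdot e^{-\delta\pi/2}$, and let $p_0,p_w$ be real numbers with $$p_0-p_w=\frac{\alpha}{2\pi}q\ln\frac{R_0}{R_w}+\beta\frac{q^2}{4\pi^2}\left(\frac{1}{R_w}-\frac{1}{R_0}\right).$$ Then $$p_0-p_w=\frac{\alpha}{2\pi}q\ln\frac{R_{0,\mathrm{Darcy}}}{R_w}+\beta\frac{q^2}{4\pi^2}\left(\frac{1}{R_w}-\frac{1}{\Delta}\right),\qquad R_{0,\mathrm{Darcy}}:=\Delta\cdot e^{-\pi/2}.$$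
   Context: Interpretation of the symbols (all real numbers): $\Delta$ is the grid block size, $R_w$ the well radius, $R_0$ the well-block radius for Forchheimer flow, $R_{0,\mathrm{Darcy}}$ the classical Peaceman well-block radius for Darcy flow, $q$ the total flow rate, $p_w$ the well pressure, $p_0$ the pressure in the grid block containing the well, $\alpha$ the Darcy coefficient and $\beta$ the Forchheimer coefficient. *)

(* Defs.v *)
From Stdlib Require Import Reals.
Open Scope R_scope.

(* R_0, the well-block radius for Forchheimer flow. *)
Definition well_block_radius (Delta delta : R) : R :=
  Delta * exp (- (delta * PI / 2)).

(* R_{0,Darcy}, Peaceman's classical well-block radius for Darcy flow. *)
Definition well_block_radius_Darcy (Delta : R) : R :=
  Delta * exp (- (PI / 2)).

(* Main.v *)
Require Import Defs.
From Stdlib Require Import Reals Lra.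
Open Scope R_scope.

(** Substituting the radii, the two expressions for [p0 - pw] differ by
    [alpha * q / 4] times the residual of the equation satisfied by [delta]. *)

(** Both radii are [Delta] times an exponential, so by [ln_scaled_exp_opp] the logarithms differ by
    [(1 - delta) * PI / 2], while [1 / R_0 - 1 / Delta] is the bracket in [hdelta]: the two
    discrepancies cancel. *)

Lemma ln_scaled_exp_opp (a b x : R) :
  0 < a -> 0 < b -> ln (a * exp (- x) / b) = ln (a / b) - x.
Proof.
intros ha hb.
replace (a * exp (- x) / b) with (a / b * exp (- x)) by (field; lra).
rewrite ln_mult, ln_exp; [ring | now apply Rdiv_lt_0_compat | apply exp_pos].
Qed.

Theorem mainTheorem4
  (alpha beta Rw Delta q delta p0 pw : R)
  (halpha : 0 < alpha) (hbeta : beta <> 0) (hRw : 0 < Rw) (hDelta : Rw < Delta)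
  (hdelta : delta + beta * (q / (alpha * PI ^ 2))
              * (exp (delta * PI / 2) / Delta - 1 / Delta) = 1)
  (hp : p0 - pw
        = alpha / (2 * PI) * q * ln (well_block_radius Delta delta / Rw)
          + beta * (q ^ 2 / (4 * PI ^ 2))
            * (1 / Rw - 1 / well_block_radius Delta delta)) :
  p0 - pw
  = alpha / (2 * PI) * q * ln (well_block_radius_Darcy Delta / Rw)
    + beta * (q ^ 2 / (4 * PI ^ 2)) * (1 / Rw - 1 / Delta).
Proof.
assert (hD : 0 < Delta) by lra.
pose proof PI_RGT_0 as hPI.
pose proof (exp_pos (delta * PI / 2)) as hE.
unfold well_block_radius, well_block_radius_Darcy in *.
rewrite !ln_scaled_exp_opp in * by assumption.
(* The only exponential left in [hp] is in [1 / R_0]; inverting it yields the one in [hdelta]. *)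
rewrite exp_Ropp in hp.
rewrite hp.
apply Rminus_diag_uniq.
set (E := exp (delta * PI / 2)) in *.
(* The factor is [alpha / (2 * PI) * q] times [PI / 2]. *)
transitivity (alpha * q / 4 *
  (1 - (delta + beta * (q / (alpha * PI ^ 2)) * (E / Delta - 1 / Delta)))).
- field; repeat split; lra.
- rewrite hdelta; ring.
Qed.
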